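(* Let $\mathcal M=(\mathcal C,\mathsf T)$ be a CBPV model such that $\mathsf T$ is lax idempotent. For every source-language type $\tau$ and object $W$ of $\mathcal C$, the monotone functions $$\phi_\tau\circ(-):\mathcal C(W,T\mathcal V[\![\tau]\!])\to\mathcal C(W,U_{\mathsf T}\mathcal N[\![\tau]\!]),\qquad \psi_\tau\circ(-):\mathcal C(W,U_{\mathsf T}\mathcal N[\![\tau]\!])\to\mathcal C(W,T\mathcal V[\![\tau]\!])$$ form a Galois connection.
   Context: **Galois connection.** Posets $X,Y$ and monotone functions $\phi:X\to Y$, $\psi:Y\to X$ form a Galois connection if $x\sqsubseteq\psi(\phi\,x)$ for all $x\in X$ and $\phi(\psi\,y)\sqsubseteq y$ for all $y\in Y$. **Order-enriched notions.** A Poset-category is a category $\mathcal C$ with a partial order $\sqsubseteq$ on each hom-set such that composition is monotone. It is cartesian if it has a terminal object $1$ (unique maps $\langle\rangle_X:X\to 1$) and binary products (projections $\pi_i$) with monotone pairing $\langle-,-\rangle$; $\mathrm{assoc}:(X_1\times X_2)\times X_3\to X_1\times(X_2\times X_3)$ is the canonical isomorphism. It is cartesian closed if moreover it has exponentials $X\Rightarrow Y$ with monotone currying $\Lambda:\mathcal C(W\times X,Y)\to\mathcal C(W,X\Rightarrow Y)$; $\mathrm{ev}=\Lambda^{-1}\mathrm{id}:(X\Rightarrow Y)\times X\to Y$. Binary coproducts are required to have monotone copairing. A strong Poset-monad $\mathsf T$ on a cartesian $\mathcal C$ consists of objects $TX$, morphisms $\eta_X:X\to TX$, and monotone functions $(-)^{\dagger(W\times\square)}:\mathcal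 C(W\times X,TY)\to\mathcal C(W\times TX,TY)$ such that: $f^{\dagger(W\times\square)}\circ(w\times \mathrm{id})=(f\circ(w\times\mathrm{id}))^{\dagger(W'\times\square)}$ for $w:W'\to W$; $f^{\dagger(W\times\square)}\circ(\mathrm{id}_W\times\eta_X)=f$; $(\eta_X\circ\pi_2)^{\dagger(1\times\square)}=\pi_2$; and $(g^{\dagger(W'\times\square)}\circ(\mathrm{id}_{W'}\times f)\circ\mathrm{assoc})^{\dagger((W'\times W)\times\square)}=g^{\dagger(W'\times\square)}\circ(\mathrm{id}_{W'}\times f^{\dagger(W\times\square)})\circ\mathrm{assoc}$ for $f:W\times X\to TY$, $g:W'\times Y\to TZ$. A $\mathsf T$-algebra $\mathsf Z$ is an object $Z=U_{\mathsf T}\mathsf Z$ (the carrier) with monotone functions $(-)^{\ddagger(W\times\square)}:\mathcal C(W\times X,Z)\to\mathcal C(W\times TX,Z)$ satisfying the same naturality in $W$, the left unit law $f^{\ddagger(W\times\square)}\circ(\mathrm{id}_W\times\eta_X)=f$, and associativity $(g^{\ddagger(W'\times\square)}\circ(\mathrm{id}_{W'}\times f)\circ\mathrm{assoc})^{\ddagger((W'\times W)\times\square)}=g^{\ddagger(W'\times\square)}\circ(\mathrm{id}_{W'}\times f^{\dagger(W\times\square)})\circ\mathrm{assoc}$ for $f:W\times X\to TY$, $g:W'\times Y\to Z$. Derived notation: for $f:X\to TY$, $f^\dagger:TX\to TY$ is the case $W=1$ (using $1\times X\cong X$); $Tf=(\eta_Y\circ f)^\dagger$ for $f:X\to Y$;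 $f^{\dagger(\square\times W)}=(f\circ\langle\pi_2,\pi_1\rangle)^{\dagger(W\times\square)}\circ\langle\pi_2,\pi_1\rangle$ for $f:X\times W\to TY$; $\mathrm{seq}^{L}_{X_1,X_2}=(\eta_{X_1\times X_2}^{\dagger(X_1\times\square)})^{\dagger(\square\times TX_2)}:TX_1\times TX_2\to T(X_1\times X_2)$; $\langle\!\langle f_1,f_2\rangle\!\rangle=\mathrm{seq}^{L}\circ\langle f_1,f_2\rangle:W\to T(X_1\times X_2)$ for $f_i:W\to TX_i$. $\mathsf T$ is lax idempotent if $T\eta_Y\sqsubseteq\eta_{TY}$ for every object $Y$. Algebra constructions: the free algebra $F_{\mathsf T}X$ has carrier $TX$ and extension $(-)^{\dagger(W\times\square)}$; the product $\mathsf Z_1\times\mathsf Z_2$ has carrier $Z_1\times Z_2$ and componentwise extension; the power $Y\Rightarrow\mathsf Z$ has carrier $Y\Rightarrow Z$ and $f^{\ddagger(W\times\square)}=\Lambda\big((\Lambda^{-1}f\circ\beta_{W,Y,X})^{\ddagger((W\times Y)\times\square)}\circ\beta_{W,TX,Y}\big)$, where $\beta_{X_1,X_2,X_3}:(X_1\times X_2)\times X_3\to(X_1\times X_3)\times X_2$ is the canonical isomorphism. A CBPV model $\mathcal M=(\mathcal C,\mathsf T)$ is a cartesian closed Poset-category $\mathcal C$ admitting the coproduct $2=1+1$, with a strong Poset-monad $\mathsf T$ on $\mathcal C$. **Types.** Source-language types are $\tau::=\mathbf{unit}\mid\mathbf{bool}\mid\tau_1\times\tau_2\mid\tau\to\tau'$.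 Call-by-value interpretation (objects): $\mathcal V[\![\mathbf{unit}]\!]=1$, $\mathcal V[\![\mathbf{bool}]\!]=2$, $\mathcal V[\![\tau_1\times\tau_2]\!]=\mathcal V[\![\tau_1]\!]\times\mathcal V[\![\tau_2]\!]$, $\mathcal V[\![\tau\to\tau']\!]=\mathcal V[\![\tau]\!]\Rightarrow T\mathcal V[\![\tau']\!]$. Call-by-name interpretation ($\mathsf T$-algebras): $\mathcal N[\![\mathbf{unit}]\!]=F_{\mathsf T}1$, $\mathcal N[\![\mathbf{bool}]\!]=F_{\mathsf T}2$, $\mathcal N[\![\tau_1\times\tau_2]\!]=\mathcal N[\![\tau_1]\!]\times\mathcal N[\![\tau_2]\!]$, $\mathcal N[\![\tau\to\tau']\!]=U_{\mathsf T}\mathcal N[\![\tau]\!]\Rightarrow\mathcal N[\![\tau']\!]$. **The maps.** $\phi_\tau:T\mathcal V[\![\tau]\!]\to U_{\mathsf T}\mathcal N[\![\tau]\!]$ and $\psi_\tau:U_{\mathsf T}\mathcal N[\![\tau]\!]\to T\mathcal V[\![\tau]\!]$ are defined by mutual induction: $\phi_{\mathbf{unit}}=\psi_{\mathbf{unit}}=\mathrm{id}_{T1}$; $\phi_{\mathbf{bool}}=\psi_{\mathbf{bool}}=\mathrm{id}_{T2}$; $\phi_{\tau_1\times\tau_2}=\langle\phi_{\tau_1}\circ T\pi_1,\phi_{\tau_2}\circ T\pi_2\rangle$; $\psi_{\tau_1\times\tau_2}=\langle\!\langle\psi_{\tau_1}\circ\pi_1,\psi_{\tau_2}\circ\pi_2\rangle\!\rangle$;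 $\phi_{\tau\to\tau'}=\Lambda(\phi_{\tau'}\circ\mathrm{ev}^\dagger\circ\langle\!\langle\pi_1,\psi_\tau\circ\pi_2\rangle\!\rangle)$; $\psi_{\tau\to\tau'}=\eta\circ\Lambda(\psi_{\tau'}\circ\mathrm{ev}\circ(\mathrm{id}\times(\phi_\tau\circ\eta)))$. *)

(* Defs.v *)
From Stdlib Require Import Relation_Definitions Setoid.

Set Implicit Arguments.
Unset Strict Implicit.
Unset Printing Implicit Defensive.

Record Poset : Type := MkPoset {
  elt :> Type;
  le : relation elt;
  le_order : order elt le
}.
Arguments le {p} _ _.

Notation "x ⊑ y" := (le x y) (at level 70, no associativity).

Definition monotone (X Y : Poset) (f : X -> Y) : Prop :=
  forall x x' : X, x ⊑ x' -> f x ⊑ f x'.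

Definition monotone2 (X Y Z : Poset) (f : X -> Y -> Z) : Prop :=
  forall (x x' : X) (y y' : Y), x ⊑ x' -> y ⊑ y' -> f x y ⊑ f x' y'.

Record GaloisConnection (X Y : Poset) (phi : X -> Y) (psi : Y -> X) : Prop := {
  gc_monotone_l : monotone phi;
  gc_monotone_r : monotone psi;
  gc_unit : forall x : X, x ⊑ psi (phi x);
  gc_counit : forall y : Y, phi (psi y) ⊑ y
}.

Record PosetCategory : Type := MkPosetCategory {
  obj :> Type;
  hom : obj -> obj -> Poset;
  idm : forall X, hom X X;
  comp : forall X Y Z, hom Y Z -> hom X Y -> hom X Z;
  comp_id_l : forall X Y (f : hom X Y), comp (idm Y) f = f;
  comp_id_r : forall X Y (f : hom X Y), comp f (idm X) = f;
  comp_assoc : forall W X Y Z (h : hom Y Z) (g : hom X Y) (f : hom W X),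
    comp (comp h g) f = comp h (comp g f);
  comp_monotone : forall X Y Z, monotone2 (@comp X Y Z)
}.
Arguments hom {p} _ _.
Arguments idm {p} X.
Arguments comp {p X Y Z} _ _.

Notation "g ∘ f" := (comp g f) (at level 40, left associativity).

Record CartesianPosetCategory : Type := MkCartesian {
  cart_cat :> PosetCategory;
  one : cart_cat;
  bang : forall X : cart_cat, hom X one;
  bang_unique : forall X (f : hom X one), f = bang X;
  prod : cart_cat -> cart_cat -> cart_cat;
  pi1 : forall X Y, hom (prod X Y) X;
  pi2 : forall X Y, hom (prod X Y) Y;
  pair : forall W X Y, hom W X -> hom W Y -> hom W (prod X Y);
  pi1_pair : forall W X Y (f : hom W X) (g : hom W Y), pi1 X Y ∘ pair f g = f;
  pi2_pair : forall W X Y (f : hom W X) (g : hom W Y), pi2 X Y ∘ pair f g = g;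
  pair_unique : forall W X Y (h : hom W (prod X Y)),
    h = pair (pi1 X Y ∘ h) (pi2 X Y ∘ h);
  pair_monotone : forall W X Y, monotone2 (@pair W X Y)
}.
Arguments one {_}.
Arguments bang {_} X.
Arguments prod {_} _ _.
Arguments pi1 {_ X Y}.
Arguments pi2 {_ X Y}.
Arguments pair {_ W X Y} _ _.

Notation "X × Y" := (prod X Y) (at level 40, left associativity).
Notation "⟨ f , g ⟩" := (pair f g) (at level 0, f at level 99, g at level 99).

Definition prod_map (C : CartesianPosetCategory) (X X' Y Y' : C)
    (f : hom X X') (g : hom Y Y') : hom (X × Y) (X' × Y') :=
  ⟨ f ∘ pi1, g ∘ pi2 ⟩.

Notation "f ⊠ g" := (prod_map f g) (at level 35, no associativity).

Definition assoc (C : CartesianPosetCategory) (X1 X2 X3 : C) :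
    hom ((X1 × X2) × X3) (X1 × (X2 × X3)) :=
  ⟨ pi1 ∘ pi1, ⟨ pi2 ∘ pi1, pi2 ⟩ ⟩.
Arguments assoc {C X1 X2 X3}.

Definition swap (C : CartesianPosetCategory) (X Y : C) : hom (X × Y) (Y × X) :=
  ⟨ pi2, pi1 ⟩.
Arguments swap {C X Y}.

Definition beta (C : CartesianPosetCategory) (X1 X2 X3 : C) :
    hom ((X1 × X2) × X3) ((X1 × X3) × X2) :=
  ⟨ ⟨ pi1 ∘ pi1, pi2 ⟩, pi2 ∘ pi1 ⟩.
Arguments beta {C X1 X2 X3}.

(* Exponentials are presented by the natural bijection [curry]; the evaluation
   map is then [uncurry id], and naturality and monotonicity of [uncurry] are
   derived below. *)
Record CartesianClosedPosetCategory : Type := MkCartesianClosed {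
  ccc_cart :> CartesianPosetCategory;
  expo : ccc_cart -> ccc_cart -> ccc_cart;
  curry : forall W X Y : ccc_cart, hom (W × X) Y -> hom W (expo X Y);
  uncurry : forall W X Y : ccc_cart, hom W (expo X Y) -> hom (W × X) Y;
  uncurry_curry : forall W X Y (f : hom (W × X) Y), uncurry (curry f) = f;
  curry_uncurry : forall W X Y (g : hom W (expo X Y)), curry (uncurry g) = g;
  curry_natural : forall W W' X Y (f : hom (W × X) Y) (w : hom W' W),
    curry f ∘ w = curry (f ∘ (w ⊠ idm X));
  curry_monotone : forall W X Y, monotone (@curry W X Y)
}.
Arguments expo {_} _ _.
Arguments curry {_ W X Y} _.
Arguments uncurry {_ W X Y} _.

Notation "X ⇒ Y" := (expo X Y) (at level 55, right associativity).

Definition ev (C : CartesianClosedPosetCategory) (X Y : C) :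
    hom ((X ⇒ Y) × X) Y :=
  uncurry (idm (X ⇒ Y)).
Arguments ev {C X Y}.

Record Coproduct (C : PosetCategory) (X Y : C) : Type := MkCoproduct {
  coprod : C;
  in1 : hom X coprod;
  in2 : hom Y coprod;
  copair : forall Z, hom X Z -> hom Y Z -> hom coprod Z;
  copair_in1 : forall Z (f : hom X Z) (g : hom Y Z), copair f g ∘ in1 = f;
  copair_in2 : forall Z (f : hom X Z) (g : hom Y Z), copair f g ∘ in2 = g;
  copair_unique : forall Z (h : hom coprod Z), h = copair (h ∘ in1) (h ∘ in2);
  copair_monotone : forall Z, monotone2 (@copair Z)
}.

Record StrongMonad (C : CartesianPosetCategory) : Type := MkStrongMonad {
  Tobj : C -> C;
  eta : forall X, hom X (Tobj X);
  ext : forall W X Y, hom (W × X) (Tobj Y) -> hom (W × Tobj X) (Tobj Y);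
  ext_monotone : forall W X Y, monotone (@ext W X Y);
  ext_natural : forall W W' X Y (f : hom (W × X) (Tobj Y)) (w : hom W' W),
    ext f ∘ (w ⊠ idm (Tobj X)) = ext (f ∘ (w ⊠ idm X));
  ext_unit_l : forall W X Y (f : hom (W × X) (Tobj Y)),
    ext f ∘ (idm W ⊠ eta X) = f;
  ext_unit_r : forall X, @ext one X X (eta X ∘ pi2) = pi2;
  ext_assoc : forall W W' X Y Z
      (f : hom (W × X) (Tobj Y)) (g : hom (W' × Y) (Tobj Z)),
    ext (ext g ∘ (idm W' ⊠ f) ∘ assoc) = ext g ∘ (idm W' ⊠ ext f) ∘ assoc
}.
Arguments Tobj {C} _ _.
Arguments eta {C} _ X.
Arguments ext {C} _ {W X Y} _.

Section Derived.
Context {C : CartesianPosetCategory} (T : StrongMonad C).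

(* The case [W = 1] of extension, transported along 1 × X ≅ X on both sides. *)
Definition ext1 (X Y : C) (f : hom X (Tobj T Y)) : hom (Tobj T X) (Tobj T Y) :=
  ext T (W := one) (f ∘ pi2) ∘ ⟨ bang (Tobj T X), idm (Tobj T X) ⟩.

Definition Tmap (X Y : C) (f : hom X Y) : hom (Tobj T X) (Tobj T Y) :=
  ext1 (eta T Y ∘ f).

Definition ext_left (X W Y : C) (f : hom (X × W) (Tobj T Y)) :
    hom (Tobj T X × W) (Tobj T Y) :=
  ext T (f ∘ swap) ∘ swap.

Definition seqL (X1 X2 : C) :
    hom (Tobj T X1 × Tobj T X2) (Tobj T (X1 × X2)) :=
  ext_left (ext T (eta T (X1 × X2))).

Definition seq_pair (W X1 X2 : C)
    (f1 : hom W (Tobj T X1)) (f2 : hom W (Tobj T X2)) :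
    hom W (Tobj T (X1 × X2)) :=
  seqL X1 X2 ∘ ⟨ f1, f2 ⟩.

Definition lax_idempotent : Prop :=
  forall Y : C, Tmap (eta T Y) ⊑ eta T (Tobj T Y).

End Derived.
Arguments ext1 {C} T {X Y} f.
Arguments Tmap {C} T {X Y} f.
Arguments seq_pair {C} T {W X1 X2} f1 f2.

Record Algebra (C : CartesianPosetCategory) (T : StrongMonad C) : Type :=
  MkAlgebra {
  U : C;
  aext : forall W X, hom (W × X) U -> hom (W × Tobj T X) U;
  aext_monotone : forall W X, monotone (@aext W X);
  aext_natural : forall W W' X (f : hom (W × X) U) (w : hom W' W),
    aext f ∘ (w ⊠ idm (Tobj T X)) = aext (f ∘ (w ⊠ idm X));
  aext_unit : forall W X (f : hom (W × X) U),
    aext f ∘ (idm W ⊠ eta T X) = f;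
  aext_assoc : forall W W' X Y
      (f : hom (W × X) (Tobj T Y)) (g : hom (W' × Y) U),
    aext (aext g ∘ (idm W' ⊠ f) ∘ assoc) = aext g ∘ (idm W' ⊠ ext T f) ∘ assoc
}.
Arguments aext {C T} _ {W X} _.

Lemma comp_mono_l (C : PosetCategory) (X Y Z : C) (f : hom X Y)
    (g g' : hom Y Z) : g ⊑ g' -> g ∘ f ⊑ g' ∘ f.
Proof.
intros H; apply comp_monotone; [exact H | apply (le_order (hom X Y))].
Qed.

Lemma comp_mono_r (C : PosetCategory) (X Y Z : C) (f f' : hom X Y)
    (g : hom Y Z) : f ⊑ f' -> g ∘ f ⊑ g ∘ f'.
Proof.
intros H; apply comp_monotone; [apply (le_order (hom Y Z)) | exact H].
Qed.

Lemma pair_comp (C : CartesianPosetCategory) (V W X Y : C)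
    (f : hom W X) (g : hom W Y) (h : hom V W) :
  ⟨ f, g ⟩ ∘ h = ⟨ f ∘ h, g ∘ h ⟩.
Proof.
rewrite (pair_unique (⟨ f, g ⟩ ∘ h)), <- !comp_assoc, pi1_pair, pi2_pair.
reflexivity.
Qed.

Lemma pair_pi (C : CartesianPosetCategory) (X Y : C) :
  ⟨ pi1, pi2 ⟩ = idm (X × Y).
Proof. rewrite (pair_unique (idm (X × Y))), !comp_id_r; reflexivity. Qed.

Lemma pair_pi_comp (C : CartesianPosetCategory) (W X Y : C)
    (h : hom W (X × Y)) : ⟨ pi1 ∘ h, pi2 ∘ h ⟩ = h.
Proof. symmetry; apply pair_unique. Qed.

Lemma uncurry_natural (C : CartesianClosedPosetCategory) (W W' X Y : C)
    (g : hom W (X ⇒ Y)) (w : hom W' W) :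
  uncurry (g ∘ w) = uncurry g ∘ (w ⊠ idm X).
Proof.
rewrite <- (curry_uncurry g) at 1; rewrite curry_natural, uncurry_curry.
reflexivity.
Qed.

Lemma uncurry_monotone (C : CartesianClosedPosetCategory) (W X Y : C) :
  monotone (@uncurry C W X Y).
Proof.
assert (E : forall g : hom W (X ⇒ Y), uncurry g = ev ∘ (g ⊠ idm X)).
{ intros g; unfold ev; rewrite <- uncurry_natural, comp_id_l; reflexivity. }
intros g g' H; rewrite !E; apply comp_mono_r.
apply pair_monotone; [apply comp_mono_l, H | apply le_order].
Qed.

Ltac cart_simpl :=
  unfold assoc, beta, swap, prod_map;
  repeat progress rewrite ?comp_assoc, ?pair_comp, ?pi1_pair, ?pi2_pair,
    ?comp_id_l, ?comp_id_r, ?pair_pi, ?pair_pi_comp.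

Definition free_algebra (C : CartesianPosetCategory) (T : StrongMonad C)
    (X : C) : Algebra T :=
  {| U := Tobj T X;
     aext := fun W Y f => ext T f;
     aext_monotone := fun W Y => @ext_monotone C T W Y X;
     aext_natural := fun W W' Y => @ext_natural C T W W' Y X;
     aext_unit := fun W Y => @ext_unit_l C T W Y X;
     aext_assoc := fun W W' Y Z => @ext_assoc C T W W' Y Z X |}.

Section ProductAlgebra.
Context {C : CartesianPosetCategory} {T : StrongMonad C} (Z1 Z2 : Algebra T).

Definition prod_aext (W X : C) (f : hom (W × X) (U Z1 × U Z2)) :
    hom (W × Tobj T X) (U Z1 × U Z2) :=
  ⟨ aext Z1 (pi1 ∘ f), aext Z2 (pi2 ∘ f) ⟩.

Lemma prod_aext_monotone W X : monotone (@prod_aext W X).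
Proof.
intros f f' H; apply pair_monotone; apply aext_monotone, comp_mono_r, H.
Qed.

Lemma prod_aext_natural W W' X (f : hom (W × X) (U Z1 × U Z2))
    (w : hom W' W) :
  prod_aext f ∘ (w ⊠ idm (Tobj T X)) = prod_aext (f ∘ (w ⊠ idm X)).
Proof.
unfold prod_aext; rewrite pair_comp, !aext_natural, !comp_assoc; reflexivity.
Qed.

Lemma prod_aext_unit W X (f : hom (W × X) (U Z1 × U Z2)) :
  prod_aext f ∘ (idm W ⊠ eta T X) = f.
Proof. unfold prod_aext; rewrite pair_comp, !aext_unit; apply pair_pi_comp. Qed.

Lemma prod_aext_assoc W W' X Y (f : hom (W × X) (Tobj T Y))
    (g : hom (W' × Y) (U Z1 × U Z2)) :
  prod_aext (prod_aext g ∘ (idm W' ⊠ f) ∘ assoc)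
  = prod_aext g ∘ (idm W' ⊠ ext T f) ∘ assoc.
Proof.
unfold prod_aext; rewrite !pair_comp, pi1_pair, pi2_pair, !aext_assoc.
reflexivity.
Qed.

Definition prod_algebra : Algebra T :=
  {| U := U Z1 × U Z2;
     aext := prod_aext;
     aext_monotone := prod_aext_monotone;
     aext_natural := prod_aext_natural;
     aext_unit := prod_aext_unit;
     aext_assoc := prod_aext_assoc |}.

End ProductAlgebra.

Section PowerAlgebra.
Context {C : CartesianClosedPosetCategory} {T : StrongMonad C}
  (Y : C) (Z : Algebra T).

Definition power_aext (W X : C) (f : hom (W × X) (Y ⇒ U Z)) :
    hom (W × Tobj T X) (Y ⇒ U Z) :=
  curry (aext Z (W := W × Y) (uncurry f ∘ beta) ∘ beta).

Lemma power_aext_monotone W X : monotone (@power_aext W X).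
Proof.
intros f f' H; apply curry_monotone, comp_mono_l, aext_monotone, comp_mono_l.
apply uncurry_monotone, H.
Qed.

Lemma power_aext_natural W W' X (f : hom (W × X) (Y ⇒ U Z))
    (w : hom W' W) :
  power_aext f ∘ (w ⊠ idm (Tobj T X)) = power_aext (f ∘ (w ⊠ idm X)).
Proof.
unfold power_aext; rewrite curry_natural, uncurry_natural; f_equal.
transitivity (aext Z (uncurry f ∘ beta)
  ∘ ((w ⊠ idm Y) ⊠ idm (Tobj T X)) ∘ beta).
{ cart_simpl; reflexivity. }
rewrite aext_natural; f_equal; f_equal; cart_simpl; reflexivity.
Qed.

Lemma power_aext_unit W X (f : hom (W × X) (Y ⇒ U Z)) :
  power_aext f ∘ (idm W ⊠ eta T X) = f.
Proof.
unfold power_aext; rewrite curry_natural.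
transitivity (curry (aext Z (uncurry f ∘ beta)
  ∘ (idm (W × Y) ⊠ eta T X) ∘ beta)).
{ f_equal; cart_simpl; reflexivity. }
rewrite aext_unit; transitivity (curry (uncurry f)).
{ f_equal; cart_simpl; reflexivity. }
apply curry_uncurry.
Qed.

Lemma power_aext_assoc W W' X X' (f : hom (W × X) (Tobj T X'))
    (g : hom (W' × X') (Y ⇒ U Z)) :
  power_aext (power_aext g ∘ (idm W' ⊠ f) ∘ assoc)
  = power_aext g ∘ (idm W' ⊠ ext T f) ∘ assoc.
Proof.
unfold power_aext.
rewrite (comp_assoc (curry _) _ assoc), (comp_assoc (curry _) _ assoc).
rewrite !curry_natural, uncurry_curry; f_equal.
set (G := aext Z (uncurry g ∘ beta)).
transitivity (aext Z (G ∘ (idm (W' × Y) ⊠ f) ∘ assoc ∘ (beta ⊠ idm X))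
  ∘ beta).
{ f_equal; f_equal; cart_simpl; reflexivity. }
rewrite <- aext_natural; unfold G; rewrite aext_assoc.
cart_simpl; reflexivity.
Qed.

Definition power_algebra : Algebra T :=
  {| U := Y ⇒ U Z;
     aext := power_aext;
     aext_monotone := power_aext_monotone;
     aext_natural := power_aext_natural;
     aext_unit := power_aext_unit;
     aext_assoc := power_aext_assoc |}.

End PowerAlgebra.

Record CBPVModel : Type := MkCBPVModel {
  model_cat :> CartesianClosedPosetCategory;
  two : Coproduct (one : model_cat) one;
  monad : StrongMonad model_cat
}.

Inductive ty : Type :=
| ty_unit : ty
| ty_bool : ty
| ty_prod : ty -> ty -> ty
| ty_arrow : ty -> ty -> ty.

Section Interpretations.
Context (M : CBPVModel).
Let T : StrongMonad M := monad M.

Fixpoint cbv (tau : ty) : M :=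
  match tau with
  | ty_unit => one
  | ty_bool => coprod (two M)
  | ty_prod tau1 tau2 => cbv tau1 × cbv tau2
  | ty_arrow tau1 tau2 => cbv tau1 ⇒ Tobj T (cbv tau2)
  end.

Fixpoint cbn (tau : ty) : Algebra T :=
  match tau with
  | ty_unit => free_algebra T one
  | ty_bool => free_algebra T (coprod (two M))
  | ty_prod tau1 tau2 => prod_algebra (cbn tau1) (cbn tau2)
  | ty_arrow tau1 tau2 => power_algebra (U (cbn tau1)) (cbn tau2)
  end.

Fixpoint phi (tau : ty) : hom (Tobj T (cbv tau)) (U (cbn tau)) :=
  match tau return hom (Tobj T (cbv tau)) (U (cbn tau)) with
  | ty_unit => idm (Tobj T one)
  | ty_bool => idm (Tobj T (coprod (two M)))
  | ty_prod tau1 tau2 => ⟨ phi tau1 ∘ Tmap T pi1, phi tau2 ∘ Tmap T pi2 ⟩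
  | ty_arrow tau1 tau2 =>
      curry (phi tau2 ∘ ext1 T ev ∘ seq_pair T pi1 (psi tau1 ∘ pi2))
  end
with psi (tau : ty) : hom (U (cbn tau)) (Tobj T (cbv tau)) :=
  match tau return hom (U (cbn tau)) (Tobj T (cbv tau)) with
  | ty_unit => idm (Tobj T one)
  | ty_bool => idm (Tobj T (coprod (two M)))
  | ty_prod tau1 tau2 => seq_pair T (psi tau1 ∘ pi1) (psi tau2 ∘ pi2)
  | ty_arrow tau1 tau2 =>
      eta T (cbv tau1 ⇒ Tobj T (cbv tau2))
      ∘ curry (psi tau2 ∘ ev
               ∘ (idm (U (cbn tau1) ⇒ U (cbn tau2)) ⊠ (phi tau1 ∘ eta T (cbv tau1))))
  end.

End Interpretations.

(* Main.v *)
Require Import Defs.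
From Stdlib Require Import Relation_Definitions.

Set Implicit Arguments.
Unset Strict Implicit.
Unset Printing Implicit Defensive.

(** Over a lax idempotent monad, extension is a left Kan extension along the
    unit: any [g : W × TX -> TY] lies above the extension of its restriction
    along [eta].  Hence it suffices to compare maps out of [TX] after restricting
    them to [X], and [T pi_i] after sequencing lies below the [i]-th projection.
    With these facts [id ⊑ psi ∘ phi] and [phi ∘ psi ⊑ id] follow together by
    induction on the type; composing with maps out of [W] gives the theorem. *)

Lemma le_refl (P : Poset) (x : P) : x ⊑ x.
Proof. apply (ord_refl _ _ (le_order P)). Qed.

Lemma le_trans (P : Poset) (y x z : P) : x ⊑ y -> y ⊑ z -> x ⊑ z.
Proof. apply (ord_trans _ _ (le_order P)). Qed.

(** * Equational laws of extension and sequencing *)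

Section StrongMonadTheory.
Context {C : CartesianPosetCategory} (T : StrongMonad C).

Lemma ext1_eta (X : C) : ext1 T (eta T X) = idm (Tobj T X).
Proof. unfold ext1; rewrite ext_unit_r, pi2_pair; reflexivity. Qed.

Lemma ext1_unit (X Y : C) (f : hom X (Tobj T Y)) : ext1 T f ∘ eta T X = f.
Proof.
unfold ext1.
transitivity (ext T (f ∘ pi2) ∘ (idm one ⊠ eta T X) ∘ ⟨ bang X, idm X ⟩).
{ cart_simpl; rewrite (bang_unique (bang _ ∘ eta T X)); reflexivity. }
rewrite ext_unit_l; cart_simpl; reflexivity.
Qed.

Lemma Tmap_eta (X Y : C) (f : hom X Y) :
  Tmap T f ∘ eta T X = eta T Y ∘ f.
Proof. apply ext1_unit. Qed.

Lemma ext1_monotone (X Y : C) : monotone (@ext1 C T X Y).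
Proof. intros f f' H; apply comp_mono_l, ext_monotone, comp_mono_l, H. Qed.

(** This is associativity with [W' = one]; naturality in the context then trades [one × W] for [W]
    along [⟨ bang W, idm W ⟩]. *)
Lemma ext1_ext (W X Y Z : C) (f : hom (W × X) (Tobj T Y))
    (g : hom Y (Tobj T Z)) : ext1 T g ∘ ext T f = ext T (ext1 T g ∘ f).
Proof.
transitivity (ext T (g ∘ pi2) ∘ (idm one ⊠ ext T f) ∘ assoc
  ∘ (⟨ bang W, idm W ⟩ ⊠ idm (Tobj T X))).
{ unfold ext1; cart_simpl; do 2 f_equal.
  rewrite (bang_unique (bang _ ∘ _)), (bang_unique (bang _ ∘ _)); reflexivity. }
rewrite <- ext_assoc, ext_natural; f_equal.
unfold ext1; cart_simpl; do 2 f_equal.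
rewrite (bang_unique (bang _ ∘ _)), (bang_unique (bang _ ∘ _)); reflexivity.
Qed.

Lemma ext_ext1 (W X Y Z : C) (f : hom X (Tobj T Y))
    (g : hom (W × Y) (Tobj T Z)) :
  ext T g ∘ (idm W ⊠ ext1 T f) = ext T (ext T g ∘ (idm W ⊠ f)).
Proof.
transitivity (ext T g ∘ (idm W ⊠ ext T (W := one) (f ∘ pi2)) ∘ assoc
  ∘ (⟨ idm W, bang W ⟩ ⊠ idm (Tobj T X))).
{ unfold ext1; cart_simpl; do 3 f_equal.
  rewrite (bang_unique (bang _ ∘ _)), (bang_unique (bang _ ∘ _)); reflexivity. }
rewrite <- ext_assoc, ext_natural; f_equal; cart_simpl; reflexivity.
Qed.

Lemma seq_pair_eta_l (W X1 X2 : C) (f1 : hom W X1) (f2 : hom W (Tobj T X2)) :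
  seq_pair T (eta T X1 ∘ f1) f2 = ext T (eta T (X1 × X2)) ∘ ⟨ f1, f2 ⟩.
Proof.
unfold seq_pair, seqL, ext_left.
transitivity (ext T (ext T (eta T (X1 × X2)) ∘ swap)
  ∘ (idm (Tobj T X2) ⊠ eta T X1) ∘ ⟨ f2, f1 ⟩).
{ cart_simpl; reflexivity. }
rewrite ext_unit_l; cart_simpl; reflexivity.
Qed.

Lemma seq_pair_eta (W X1 X2 : C) (f1 : hom W X1) (f2 : hom W X2) :
  seq_pair T (eta T X1 ∘ f1) (eta T X2 ∘ f2) = eta T (X1 × X2) ∘ ⟨ f1, f2 ⟩.
Proof.
rewrite seq_pair_eta_l.
transitivity (ext T (eta T (X1 × X2)) ∘ (idm X1 ⊠ eta T X2) ∘ ⟨ f1, f2 ⟩).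
{ cart_simpl; reflexivity. }
rewrite ext_unit_l; reflexivity.
Qed.

Lemma seq_pair_comp (V W X1 X2 : C) (f1 : hom W (Tobj T X1))
    (f2 : hom W (Tobj T X2)) (h : hom V W) :
  seq_pair T f1 f2 ∘ h = seq_pair T (f1 ∘ h) (f2 ∘ h).
Proof. unfold seq_pair; rewrite comp_assoc, pair_comp; reflexivity. Qed.

Lemma seq_pair_monotone (W X1 X2 : C) : monotone2 (@seq_pair C T W X1 X2).
Proof.
intros f f' g g' Hf Hg; apply comp_mono_r, pair_monotone; assumption.
Qed.

(** [seqL] is a nested extension of [eta]: [ext1_ext] pushes [ext1 T g] through both layers, and the
    unit law absorbs it into the innermost [eta]. *)
Lemma ext1_seqL (X1 X2 Y : C) (g : hom (X1 × X2) (Tobj T Y)) :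
  ext1 T g ∘ seqL T X1 X2 = ext_left (ext T g).
Proof.
unfold seqL, ext_left.
rewrite <- comp_assoc, ext1_ext, <- comp_assoc, ext1_ext, ext1_unit.
reflexivity.
Qed.

(** * Inequalities from lax idempotency *)

Section LaxIdempotent.
Hypothesis lax : lax_idempotent T.

(* Write [g = ext g ∘ (id ⊠ eta)]; then the left side is [ext g ∘ (id ⊠ T eta)]. *)
Lemma ext_restrict_le (W X Y : C) (g : hom (W × Tobj T X) (Tobj T Y)) :
  ext T (g ∘ (idm W ⊠ eta T X)) ⊑ g.
Proof.
assert (E : ext T (g ∘ (idm W ⊠ eta T X))
            = ext T g ∘ (idm W ⊠ Tmap T (eta T X))).
{ unfold Tmap; rewrite ext_ext1; f_equal.
  rewrite <- (ext_unit_l g) at 1; cart_simpl; reflexivity. }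
rewrite E; apply le_trans with (ext T g ∘ (idm W ⊠ eta T (Tobj T X))).
2: { rewrite ext_unit_l; apply le_refl. }
apply comp_mono_r, pair_monotone; [apply le_refl | apply comp_mono_l, lax].
Qed.

Lemma ext1_restrict_le (X Y : C) (g : hom (Tobj T X) (Tobj T Y)) :
  ext1 T (g ∘ eta T X) ⊑ g.
Proof.
unfold ext1.
apply le_trans with (g ∘ pi2 ∘ ⟨ bang (Tobj T X), idm (Tobj T X) ⟩).
{ apply comp_mono_l.
  replace (g ∘ eta T X ∘ pi2) with (g ∘ pi2 ∘ (idm one ⊠ eta T X))
    by (cart_simpl; reflexivity).
  apply ext_restrict_le. }
cart_simpl; apply le_refl.
Qed.

(** The identity is the extension of [eta], so the Kan property reduces the comparison to pure
    values. *)
Lemma id_le_of_eta_le (X : C) (g : hom (Tobj T X) (Tobj T X)) :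
  eta T X ⊑ g ∘ eta T X -> idm (Tobj T X) ⊑ g.
Proof.
intros H; rewrite <- ext1_eta.
apply le_trans with (2 := ext1_restrict_le g), ext1_monotone, H.
Qed.

Lemma ext_left_restrict_le (X W Y : C) (g : hom (Tobj T X × W) (Tobj T Y)) :
  ext_left (g ∘ (eta T X ⊠ idm W)) ⊑ g.
Proof.
unfold ext_left.
apply le_trans with (g ∘ swap ∘ swap).
{ apply comp_mono_l.
  replace (g ∘ (eta T X ⊠ idm W) ∘ swap)
    with (g ∘ swap ∘ (idm W ⊠ eta T X)) by (cart_simpl; reflexivity).
  apply ext_restrict_le. }
cart_simpl; apply le_refl.
Qed.

Lemma ext_left_monotone (X W Y : C) : monotone (@ext_left C T X W Y).
Proof. intros f f' H; apply comp_mono_l, ext_monotone, comp_mono_l, H. Qed.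

(** The Kan property in two arguments: by [ext1_seqL] the left side is an iterated extension, so
    each restriction along [eta] is undone in turn, the second argument first. *)
Lemma ext1_seqL_le (X1 X2 Y : C) (g : hom (Tobj T X1 × Tobj T X2) (Tobj T Y)) :
  ext1 T (g ∘ (eta T X1 ⊠ eta T X2)) ∘ seqL T X1 X2 ⊑ g.
Proof.
rewrite ext1_seqL.
apply le_trans with (2 := ext_left_restrict_le g), ext_left_monotone.
replace (g ∘ (eta T X1 ⊠ eta T X2))
  with (g ∘ (eta T X1 ⊠ idm (Tobj T X2)) ∘ (idm X1 ⊠ eta T X2))
  by (cart_simpl; reflexivity).
apply ext_restrict_le.
Qed.

(** The case of [ext1_seqL_le] where [g] is the projection out of [Tobj T X1 × Tobj T X2]. *)
Lemma Tmap_pi1_seq_pair_le (W X1 X2 : C) (f1 : hom W (Tobj T X1))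
    (f2 : hom W (Tobj T X2)) : Tmap T pi1 ∘ seq_pair T f1 f2 ⊑ f1.
Proof.
unfold seq_pair, Tmap; rewrite <- comp_assoc.
rewrite <- (pi1_pair f1 f2) at 2; apply comp_mono_l.
replace (eta T X1 ∘ pi1) with (pi1 ∘ (eta T X1 ⊠ eta T X2))
  by (cart_simpl; reflexivity).
apply ext1_seqL_le.
Qed.

Lemma Tmap_pi2_seq_pair_le (W X1 X2 : C) (f1 : hom W (Tobj T X1))
    (f2 : hom W (Tobj T X2)) : Tmap T pi2 ∘ seq_pair T f1 f2 ⊑ f2.
Proof.
unfold seq_pair, Tmap; rewrite <- comp_assoc.
rewrite <- (pi2_pair f1 f2) at 2; apply comp_mono_l.
replace (eta T X2 ∘ pi2) with (pi2 ∘ (eta T X1 ⊠ eta T X2))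
  by (cart_simpl; reflexivity).
apply ext1_seqL_le.
Qed.

(** After restriction along [eta] both components become pure, and sequencing them rebuilds the pair
    exactly. *)
Lemma id_le_seq_pair_Tmap_pi (X1 X2 : C) :
  idm (Tobj T (X1 × X2)) ⊑ seq_pair T (Tmap T pi1) (Tmap T pi2).
Proof.
apply id_le_of_eta_le.
rewrite seq_pair_comp, !Tmap_eta, seq_pair_eta, pair_pi, comp_id_r; apply le_refl.
Qed.

End LaxIdempotent.
End StrongMonadTheory.

(** * Comparing maps into exponentials, and cancelling below or above the identity *)

Lemma curry_ev (C : CartesianClosedPosetCategory) (W X Y : C)
    (f : hom (W × X) Y) : ev ∘ (curry f ⊠ idm X) = f.
Proof.
unfold ev; rewrite <- uncurry_natural, comp_id_l; apply uncurry_curry.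
Qed.

Lemma le_of_ev_le (C : CartesianClosedPosetCategory) (W X Y : C)
    (f g : hom W (X ⇒ Y)) :
  ev ∘ (f ⊠ idm X) ⊑ ev ∘ (g ⊠ idm X) -> f ⊑ g.
Proof.
intros H; rewrite <- (curry_uncurry f), <- (curry_uncurry g).
apply curry_monotone; unfold ev in H.
rewrite <- !uncurry_natural, !comp_id_l in H; exact H.
Qed.

Lemma comp_le_of_le_id (C : PosetCategory) (X Y : C) (e : hom Y Y)
    (f g : hom X Y) : e ⊑ idm Y -> f ⊑ g -> e ∘ f ⊑ g.
Proof.
intros He H; rewrite <- (comp_id_l g); apply comp_monotone; assumption.
Qed.

Lemma le_comp_of_id_le (C : PosetCategory) (X Y : C) (e : hom Y Y)
    (f g : hom X Y) : idm Y ⊑ e -> f ⊑ g -> f ⊑ e ∘ g.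
Proof.
intros He H; rewrite <- (comp_id_l f); apply comp_monotone; assumption.
Qed.

(** * The adjunction between [phi] and [psi], type by type *)

Section PhiPsi.
Context (M : CBPVModel).
Local Notation T := (monad M).
Hypothesis lax : lax_idempotent T.

Local Notation adjoint t :=
  (idm _ ⊑ psi M t ∘ phi M t /\ phi M t ∘ psi M t ⊑ idm _).

Lemma phi_psi_prod (t1 t2 : ty) :
  adjoint t1 -> adjoint t2 -> adjoint (ty_prod t1 t2).
Proof.
intros [u1 c1] [u2 c2]; cbn [phi psi cbv cbn U prod_algebra]; split.
- rewrite seq_pair_comp, !comp_assoc, pi1_pair, pi2_pair.
  apply le_trans with (1 := id_le_seq_pair_Tmap_pi lax _ _).
  apply seq_pair_monotone; rewrite <- comp_assoc;
    (apply le_comp_of_id_le; [assumption | apply le_refl]).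
- rewrite pair_comp, <- pair_pi, !comp_assoc.
  apply pair_monotone.
  + apply le_trans with (phi M t1 ∘ (psi M t1 ∘ pi1)).
    { apply comp_mono_r, Tmap_pi1_seq_pair_le, lax. }
    rewrite <- comp_assoc; apply comp_le_of_le_id; [assumption | apply le_refl].
  + apply le_trans with (phi M t2 ∘ (psi M t2 ∘ pi2)).
    { apply comp_mono_r, Tmap_pi2_seq_pair_le, lax. }
    rewrite <- comp_assoc; apply comp_le_of_le_id; [assumption | apply le_refl].
Qed.

Lemma ev_phi_arrow (t1 t2 : ty) (W : M)
    (f : hom W (Tobj T (cbv M t1 ⇒ Tobj T (cbv M t2)))) :
  ev ∘ ((phi M (ty_arrow t1 t2) ∘ f) ⊠ idm (U (cbn M t1)))
  = phi M t2 ∘ (ext1 T ev ∘ seq_pair T (f ∘ pi1) (psi M t1 ∘ pi2)).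
Proof.
cbn [phi cbv cbn U power_algebra].
transitivity (ev ∘ (curry (phi M t2 ∘ ext1 T ev
  ∘ seq_pair T pi1 (psi M t1 ∘ pi2)) ⊠ idm _) ∘ (f ⊠ idm (U (cbn M t1)))).
{ cart_simpl; reflexivity. }
rewrite curry_ev, !comp_assoc, seq_pair_comp; cart_simpl; reflexivity.
Qed.

Definition psi_body (t1 t2 : ty) :
    hom ((U (cbn M t1) ⇒ U (cbn M t2)) × cbv M t1) (Tobj T (cbv M t2)) :=
  psi M t2 ∘ ev ∘ (idm _ ⊠ (phi M t1 ∘ eta T (cbv M t1))).

Lemma phi_psi_arrow (t1 t2 : ty) :
  adjoint t1 -> adjoint t2 -> adjoint (ty_arrow t1 t2).
Proof.
intros [u1 c1] [u2 c2].
assert (E : psi M (ty_arrow t1 t2) = eta T _ ∘ curry (psi_body t1 t2))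
  by reflexivity.
rewrite E; clear E.
(* From here on, [phi] at the arrow type is an opaque [p], known only through its evaluation
   equation; this keeps reduction from unfolding it. *)
pose proof (ev_phi_arrow (t1 := t1) (t2 := t2)) as ev_phi.
revert ev_phi; generalize (phi M (ty_arrow t1 t2)).
cbn [cbv cbn U power_algebra]; intros p ev_phi; split.
(* Unit: on pure functions both sides factor through [eta], so it suffices to compare the underlying
   functions by evaluating them. *)
- apply id_le_of_eta_le; [exact lax |].
  rewrite <- (comp_id_r (eta T (cbv M t1 ⇒ Tobj T (cbv M t2)))) at 1.
  rewrite !comp_assoc; apply comp_mono_r, le_of_ev_le.
  set (q := p ∘ _).
  replace (ev ∘ ((curry (psi_body t1 t2) ∘ q) ⊠ idm (cbv M t1)))
    with (ev ∘ (curry (psi_body t1 t2) ⊠ idm _) ∘ (q ⊠ idm (cbv M t1)))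
    by (cart_simpl; reflexivity).
  rewrite curry_ev; unfold psi_body.
  replace (psi M t2 ∘ ev ∘ (idm _ ⊠ (phi M t1 ∘ eta T (cbv M t1))) ∘ (q ⊠ idm _))
    with (psi M t2 ∘ (ev ∘ (q ⊠ idm _)
            ∘ (idm _ ⊠ (phi M t1 ∘ eta T (cbv M t1)))))
    by (cart_simpl; reflexivity).
  unfold q; rewrite ev_phi, !comp_assoc, <- (comp_assoc (psi M t2)).
  apply le_comp_of_id_le; [exact u2 |].
  rewrite seq_pair_comp.
  (* The intermediate term has the pure argument in place of [psi ∘ phi ∘ eta] at [t1]: it evaluates
     to [ev], and [u1] bounds it from above. *)
  apply le_trans with (ext1 T ev ∘ seq_pair T (eta T _ ∘ pi1) (eta T _ ∘ pi2)).
  { rewrite seq_pair_eta, <- comp_assoc, ext1_unit; apply comp_mono_r.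
    cart_simpl; apply le_refl. }
  apply comp_mono_r, seq_pair_monotone; cart_simpl; [apply le_refl |].
  rewrite <- comp_assoc; apply le_comp_of_id_le; [exact u1 | apply le_refl].
- apply le_of_ev_le; rewrite ev_phi.
  (* Counit: the function component is pure, so sequencing collapses and only the extension of [ev]
     in its argument remains. *)
  rewrite comp_assoc, seq_pair_eta_l, <- (comp_assoc (ext1 T ev)), ext1_ext, ext1_unit.
  replace ⟨ curry (psi_body t1 t2) ∘ pi1, psi M t1 ∘ pi2 ⟩
    with ((curry (psi_body t1 t2) ⊠ idm (Tobj T (cbv M t1))) ∘ (idm _ ⊠ psi M t1))
    by (cart_simpl; reflexivity).
  rewrite <- (comp_assoc (ext T ev)), ext_natural, curry_ev.
  apply le_trans with (phi M t2 ∘ (psi M t2 ∘ ev ∘ (idm _ ⊠ phi M t1)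
    ∘ (idm _ ⊠ psi M t1))).
  { apply comp_mono_r, comp_mono_l.
    (* [psi_body] is the restriction along [eta] of a map defined on all of [T (cbv M t1)], so the
       Kan property bounds its extension by that map; [c2] and [c1] then cancel the remaining
       composites. *)
    replace (psi_body t1 t2)
      with (psi M t2 ∘ ev ∘ (idm _ ⊠ phi M t1) ∘ (idm _ ⊠ eta T (cbv M t1)))
      by (unfold psi_body; cart_simpl; reflexivity).
    apply ext_restrict_le, lax. }
  rewrite !comp_assoc, <- (comp_assoc (phi M t2)).
  apply comp_le_of_le_id; [exact c2 | apply comp_mono_r].
  cart_simpl; rewrite <- comp_assoc, <- pair_pi.
  apply pair_monotone; [apply le_refl |].
  apply comp_le_of_le_id; [exact c1 | apply le_refl].
Qed.

Lemma phi_psi_adjoint (t : ty) : adjoint t.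
Proof.
induction t as [ | | t1 IH1 t2 IH2 | t1 IH1 t2 IH2].
- simpl; rewrite comp_id_l; split; apply le_refl.
- simpl; rewrite comp_id_l; split; apply le_refl.
- apply phi_psi_prod; assumption.
- apply phi_psi_arrow; assumption.
Qed.

End PhiPsi.

Theorem corollary5p9 :
  forall (M : CBPVModel), lax_idempotent (monad M) ->
  forall (tau : ty) (W : M),
    GaloisConnection
      (X := hom W (Tobj (monad M) (cbv M tau)))
      (Y := hom W (U (cbn M tau)))
      (fun f => phi M tau ∘ f)
      (fun g => psi M tau ∘ g).
Proof.
intros M lax tau W; destruct (phi_psi_adjoint lax tau) as [u c]; split.
- intros f f' H; apply comp_mono_r, H.
- intros g g' H; apply comp_mono_r, H.
- intros f; rewrite <- comp_assoc.
  apply le_comp_of_id_le; [exact u | apply le_refl].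
- intros g; rewrite <- comp_assoc.
  apply comp_le_of_le_id; [exact c | apply le_refl].
Qed.
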